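(* Let $M(\phi,\xi,\eta,g_M)$ be a cosymplectic manifold, $(N,g_N)$ a Riemannian manifold, and $F:M\to N$ a slant Riemannian submersion such that $\xi$ is vertical. Then the distribution $\ker F_*$ defines a totally geodesic foliation on $M$ if and only if $$g_M(\mathcal H\nabla_U\omega\psi V,X)=g_M(\mathcal T_U\omega V,\mathcal BX)+g_M(\mathcal H\nabla_U\omega V,\mathcal CX)$$ for any $U,V\in\Gamma(\ker F_* )$ and $X\in\Gamma((\ker F_* )^\perp)$.
   Context: An almost contact metric structure $(\phi,\xi,\eta,g_M)$ on an odd-dimensional manifold $M$ consists of a $(1,1)$-tensor $\phi$, a vector field $\xi$, a $1$-form $\eta$ and a Riemannian metric $g_M$ with $\phi^2=-I+\eta\otimes\xi$, $\phi\xi=0$, $\eta\circ\phi=0$, $\eta(\xi)=1$, $g_M(\phi X,\phi Y)=g_M(X,Y)-\eta(X)\eta(Y)$, $\eta(X)=g_M(X,\xi)$. It is cosymplectic if it is normal and $\eta$ and $\Phi(X,Y)=g_M(X,\phi Y)$ are closed; the structure equation is $\nabla\phi=0$, and then $\nabla\xi=0$ ($\nabla$ the Levi-Civita connection of $g_M$). A Riemannian submersion $F:(M,g_M)\to(N,g_N)$ is a smooth surjective map of maximal rank such that $F_*$ preserves the lengths of horizontal vectors. Vertical means in $\ker F_*$, horizontal means in $(\ker F_* )^\perp$; $\mathcal V,\mathcal H$ are the corresponding orthogonal projections. O'Neill's tensor $\mathcal T$ is $\mathcal T_EG=\mathcal H\nabla_{\mathcal VE}\mathcal VG+\mathcal V\nabla_{\mathcal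 VE}\mathcal HG$. For vertical $U$: $\phi U=\psi U+\omega U$ with $\psi U$ vertical, $\omega U$ horizontal. For horizontal $X$: $\phi X=\mathcal BX+\mathcal CX$ with $\mathcal BX$ vertical, $\mathcal CX$ horizontal. $F$ is slant if for every nonzero vertical vector $X$ (not a multiple of $\xi$) the angle between $\phi X$ and $\ker F_*$ is a constant $\theta$ (the slant angle) independent of the point and of $X$. A distribution $D$ defines a totally geodesic foliation if it is integrable with totally geodesic leaves, i.e. $\nabla_XY\in\Gamma(D)$ for all $X,Y\in\Gamma(D)$.
   Formalization: The slant angle θ is assumed nonzero; for θ = 0 (φ-invariant fibres) ω vanishes on ker F_*, the displayed equation reads 0 = 0, and the claim fails, since an invariant submersion need not have totally geodesic fibres. *)

(* Defs.v *)
From HB Require Import structures.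
From mathcomp Require Import all_boot all_order all_algebra.
From mathcomp Require Import all_classical all_reals all_analysis.
From mathcomp Require Import ring.

Set Implicit Arguments.
Unset Strict Implicit.
Unset Printing Implicit Defensive.

Import Order.TTheory GRing.Theory Num.Theory.
Import numFieldNormedType.Exports.

Local Open Scope classical_set_scope.
Local Open Scope ring_scope.

Section EuclideanSmoothness.
Variables (R : realType) (n : nat).
Implicit Types (A : set 'rV[R]_n) (f g : 'rV[R]_n -> R).

(* class C^k through iterated partial derivatives; meaningful for A open *)
Fixpoint Ck (k : nat) A f : Prop :=
  (forall x, A x -> {for x, continuous f}) /\
  (if k is k'.+1 then
     forall i : 'I_n, (forall x, A x -> derivable f x (delta_mx 0 i)) /\
                      Ck k' A (fun x => 'D_(delta_mx 0 i) f x)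
   else True).

Definition Coo A f : Prop := forall k, Ck k A f.

Lemma Ck_continuous k A f : Ck k A f -> forall x, A x -> {for x, continuous f}.
Proof. by case: k => [|k] []. Qed.

Lemma Ck_pred k A f : Ck k.+1 A f -> Ck k A f.
Proof.
elim: k f => [|k IH] f; first by case.
by move=> [cf df]; split=> // i; have [? ?] := df i; split=> //; exact: IH.
Qed.

Lemma near_eq_continuous f g x : {near x, f =1 g} ->
  {for x, continuous f} -> {for x, continuous g}.
Proof.
move=> fg; rewrite /prop_for /continuous_at -(nbhs_singleton fg).
exact: cvg_trans (@near_eq_cvg _ _ (nbhs (x : 'rV[R]_n)) _ f g fg).
Qed.

Lemma Ck_ext k A f g : open A -> (forall x, A x -> f x = g x) ->
  Ck k A f -> Ck k A g.
Proof.
move=> oA; elim: k f g => [|k IH] f g fg.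
all: have nfg x : A x -> {near x, f =1 g}
  by move=> Ax; apply: (filterS fg); exact: open_nbhs_nbhs.
  by move=> [cf _]; split=> // x Ax; exact: near_eq_continuous (nfg x Ax) (cf x Ax).
move=> [cf df]; split.
  by move=> x Ax; exact: near_eq_continuous (nfg x Ax) (cf x Ax).
move=> i; have [d1 d2] := df i; split.
  by move=> x Ax; exact: near_eq_derivable (nfg x Ax) (d1 x Ax).
by apply: IH d2 => x Ax; exact: near_eq_derive (nfg x Ax).
Qed.

Lemma Ck_cst k A (c : R) : open A -> Ck k A (cst c).
Proof.
move=> oA; elim: k c => [|k IH] c.
  by split=> // x _; exact: cst_continuous.
split; first by move=> x _; exact: cst_continuous.
move=> i; split; first by move=> x _; exact: derivable_cst.
apply: Ck_ext (IH 0) => // x _.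
by rewrite derive_cst.
Qed.

Lemma CkD k A f g : open A -> Ck k A f -> Ck k A g -> Ck k A (f + g).
Proof.
move=> oA; elim: k f g => [|k IH] f g [cf df] [cg dg].
  by split=> // x Ax; apply: continuousD; [exact: cf|exact: cg].
split.
  by move=> x Ax; apply: continuousD; [exact: cf|exact: cg].
move=> i; have [f1 f2] := df i; have [g1 g2] := dg i; split.
  by move=> x Ax; apply: derivableD; [exact: f1|exact: g1].
apply: Ck_ext (IH _ _ f2 g2) => // x Ax.
by rewrite deriveD//; [exact: f1|exact: g1].
Qed.

Lemma CkM k A f g : open A -> Ck k A f -> Ck k A g -> Ck k A (f * g).
Proof.
move=> oA; elim: k f g => [|k IH] f g.
  by move=> [cf _] [cg _]; split=> // x Ax; apply: continuousM;
    [exact: cf|exact: cg].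
move=> cdf cdg; have := cdf; have := cdg; move=> [cg dg] [cf df]; split.
  by move=> x Ax; apply: continuousM; [exact: cf|exact: cg].
move=> i; have [f1 f2] := df i; have [g1 g2] := dg i; split.
  by move=> x Ax; apply: derivableM; [exact: f1|exact: g1].
have h1 := IH _ _ (Ck_pred cdf) g2; have h2 := IH _ _ (Ck_pred cdg) f2.
apply: Ck_ext (CkD oA h1 h2) => // x Ax.
by rewrite deriveM//; [exact: f1|exact: g1].
Qed.

End EuclideanSmoothness.

Record chart (R : realType) (n : nat) (M : topologicalType) := Chart {
  chart_dom : set M;
  chart_cod : set 'rV[R]_n;
  chart_ev : M -> 'rV[R]_n;
  chart_inv : 'rV[R]_n -> M;
  chart_dom_open : open chart_dom;
  chart_cod_open : open chart_cod;
  chart_ev_cod : forall p, chart_dom p -> chart_cod (chart_ev p);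
  chart_inv_dom : forall x, chart_cod x -> chart_dom (chart_inv x);
  chart_evK : forall p, chart_dom p -> chart_inv (chart_ev p) = p;
  chart_invK : forall x, chart_cod x -> chart_ev (chart_inv x) = x;
  chart_ev_continuous : forall p, chart_dom p -> {for p, continuous chart_ev};
  chart_inv_continuous : forall x, chart_cod x -> {for x, continuous chart_inv}
}.

Definition chart_image (R : realType) (n : nat) (M : topologicalType)
    (c : chart R n M) (W : set M) : set 'rV[R]_n :=
  chart_cod c `&` chart_inv c @^-1` W.

Lemma chart_image_open (R : realType) (n : nat) (M : topologicalType)
    (c : chart R n M) (W : set M) : open W -> open (chart_image c W).
Proof.
move=> oW; rewrite openE => x [cx Wx]; apply: filterI.
  by apply: open_nbhs_nbhs; split=> //; exact: chart_cod_open.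
by apply: (chart_inv_continuous cx); exact: open_nbhs_nbhs.
Qed.

(* The atlas need not be maximal: all notions below only depend on the maximal
   atlas it generates. *)
Record manifold (R : realType) (n : nat) := Manifold {
  mpoint :> topologicalType;
  mhausdorff : hausdorff_space mpoint;
  msecond_countable : @second_countable mpoint;
  atlas : set (chart R n mpoint);
  atlas_cover : forall p : mpoint, exists2 c, atlas c & chart_dom c p;
  atlas_compat : forall c d, atlas c -> atlas d -> forall j : 'I_n,
    Coo (chart_image c (chart_dom d))
        (fun x => chart_ev d (chart_inv c x) 0 j)
}.

Definition smooth_on (R : realType) (n : nat) (M : manifold R n)
    (W : set M) (f : M -> R) : Prop :=
  forall c, atlas c -> Coo (chart_image c W) (f \o chart_inv c).

Section SmoothFunctions.
Variables (R : realType) (n : nat) (M : manifold R n).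

Definition smooth_fun_pred : {pred M -> R} :=
  fun f => `[< smooth_on [set: M] f >].

Record smooth_fun := SmoothFun {
  smooth_fun_val :> M -> R;
  smooth_funP : smooth_fun_val \in smooth_fun_pred
}.

HB.instance Definition _ := [isSub for smooth_fun_val].
HB.instance Definition _ := [Choice of smooth_fun by <:].

Lemma smooth_fun_mulr_closed : mulr_closed smooth_fun_pred.
Proof.
split.
  by apply/asboolP => c Ac k; apply: Ck_cst; exact/chart_image_open/openT.
move=> f g /asboolP sf /asboolP sg; apply/asboolP => c Ac k.
apply: (CkM (chart_image_open openT) (sf c Ac k) (sg c Ac k)).
Qed.

Lemma smooth_fun_scaler_closed : scaler_closed smooth_fun_pred.
Proof.
move=> a f /asboolP sf; apply/asboolP => c Ac k.
by apply: (CkM _ (Ck_cst k a _) (sf c Ac k)); exact/chart_image_open/openT.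
Qed.

Lemma smooth_fun_subring_closed : subring_closed smooth_fun_pred.
Proof.
have [s1 sM] := smooth_fun_mulr_closed.
split=> // f g /asboolP sf sg.
have /asboolP sNg := smooth_fun_scaler_closed (-1) sg.
apply/asboolP => c Ac k.
have -> : f - g = f + (-1) *: g by rewrite scaleN1r.
apply: (CkD (chart_image_open openT) (sf c Ac k) (sNg c Ac k)).
Qed.

HB.instance Definition _ :=
  GRing.isSubringClosed.Build _ smooth_fun_pred smooth_fun_subring_closed.
HB.instance Definition _ :=
  GRing.isScaleClosed.Build _ _ smooth_fun_pred smooth_fun_scaler_closed.
HB.instance Definition _ :=
  GRing.SubChoice_isSubComPzRing.Build _ _ smooth_fun
    smooth_fun_subring_closed.
HB.instance Definition _ := [SubZmodule_isSubLmodule of smooth_fun by <:].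

End SmoothFunctions.

Section TangentSpaces.
Variables (R : realType) (n : nat) (M : manifold R n).

Section TangentSpaceAt.
Variable p : M.

(* a tangent vector at p is a derivation at p of the algebra C^oo(M) *)
Definition derivation_at : {pred smooth_fun M -> R} := fun v =>
  `[< (forall (a : R) f g, v (a *: f + g) = a * v f + v g) /\
      (forall f g, v (f * g) = v f * g p + f p * v g) >].

Record tangent := Tangent {
  tangent_val :> smooth_fun M -> R;
  tangentP : tangent_val \in derivation_at
}.

HB.instance Definition _ := [isSub for tangent_val].
HB.instance Definition _ := [Choice of tangent by <:].

Lemma derivation_at_submod_closed : submod_closed derivation_at.
Proof.
split.
  by apply/asboolP; split=> [a f g|f g]; rewrite /= ?mulr0 ?mul0r ?addr0.
move=> a u v /asboolP[ul uM] /asboolP[vl vM]; apply/asboolP.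
split=> [b f g|f g].
  rewrite -[LHS]/(a * u (b *: f + g) + v (b *: f + g)) ul vl.
  rewrite -[RHS]/(b * (a * u f + v f) + (a * u g + v g)).
  by rewrite !mulrDr !mulrA (mulrC b a) addrACA.
rewrite -[LHS]/(a * u (f * g) + v (f * g)) uM vM.
rewrite -[RHS]/((a * u f + v f) * g p + f p * (a * u g + v g)).
by rewrite !mulrDr mulrDl !mulrA (mulrC (f p) a) addrACA.
Qed.

HB.instance Definition _ :=
  GRing.isSubmodClosed.Build _ _ derivation_at derivation_at_submod_closed.
HB.instance Definition _ := [SubChoice_isSubLmodule of tangent by <:].

End TangentSpaceAt.

Record vfield := VField {
  vfield_val :> forall p : M, tangent p;
  vfield_smooth : forall f : smooth_fun M,
    (fun p => vfield_val p f) \in @smooth_fun_pred R n M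
}.

Definition vder (X : vfield) (f : smooth_fun M) : smooth_fun M :=
  SmoothFun (vfield_smooth X f).

Lemma vfield_eqP (X Y : vfield) : (forall p, X p = Y p) -> X = Y.
Proof.
case: X Y => [X Xs] [Y Ys] /= XY.
have {}XY : X = Y by exact: functional_extensionality_dep.
by subst Y; congr VField; exact: Prop_irrelevance.
Qed.

HB.instance Definition _ := gen_eqMixin vfield.
HB.instance Definition _ := gen_choiceMixin vfield.

Fact vfield0_smooth (f : smooth_fun M) :
  (fun p => (0 : tangent p) f) \in @smooth_fun_pred R n M.
Proof. exact: rpred0. Qed.

Fact vfieldD_smooth (X Y : vfield) (f : smooth_fun M) :
  (fun p => (X p + Y p) f) \in @smooth_fun_pred R n M.
Proof. exact: rpredD (vfield_smooth X f) (vfield_smooth Y f). Qed.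

Fact vfieldN_smooth (X : vfield) (f : smooth_fun M) :
  (fun p => (- X p) f) \in @smooth_fun_pred R n M.
Proof. by have := vfield_smooth X f; rewrite -rpredN. Qed.

Fact vfieldZ_smooth (h : smooth_fun M) (X : vfield) (f : smooth_fun M) :
  (fun p => (h p *: X p) f) \in @smooth_fun_pred R n M.
Proof. exact: rpredM (smooth_funP h) (vfield_smooth X f). Qed.

Let vfield0 := VField vfield0_smooth.
Let vfieldD X Y := VField (vfieldD_smooth X Y).
Let vfieldN X := VField (vfieldN_smooth X).
Let vfieldZ h X := VField (vfieldZ_smooth h X).

Let vfieldDA : associative vfieldD.
Proof. by move=> X Y Z; apply: vfield_eqP => p; exact: addrA. Qed.
Let vfieldDC : commutative vfieldD.
Proof. by move=> X Y; apply: vfield_eqP => p; exact: addrC. Qed.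
Let vfield0D : left_id vfield0 vfieldD.
Proof. by move=> X; apply: vfield_eqP => p; exact: add0r. Qed.
Let vfieldND : left_inverse vfield0 vfieldN vfieldD.
Proof. by move=> X; apply: vfield_eqP => p; exact: addNr. Qed.

HB.instance Definition _ :=
  GRing.isZmodule.Build vfield vfieldDA vfieldDC vfield0D vfieldND.

Let vfieldZA h k X : vfieldZ h (vfieldZ k X) = vfieldZ (h * k) X.
Proof. by apply: vfield_eqP => p; exact: scalerA. Qed.
Let vfield1Z : left_id 1 vfieldZ.
Proof. by move=> X; apply: vfield_eqP => p; exact: scale1r. Qed.
Let vfieldZDr : right_distributive vfieldZ +%R.
Proof. by move=> h X Y; apply: vfield_eqP => p; exact: scalerDr. Qed.
Let vfieldZDl X : {morph vfieldZ^~ X : h k / h + k}.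
Proof. by move=> h k; apply: vfield_eqP => p; exact: scalerDl. Qed.

HB.instance Definition _ := GRing.Zmodule_isLmodule.Build (smooth_fun M) vfield
  vfieldZA vfield1Z vfieldZDr vfieldZDl.

Lemma vfield0E p : (0 : vfield) p = 0. Proof. by []. Qed.
Lemma vfieldDE (X Y : vfield) p : (X + Y) p = X p + Y p. Proof. by []. Qed.
Lemma vfieldNE (X : vfield) p : (- X) p = - X p. Proof. by []. Qed.
Lemma vfieldZE (h : smooth_fun M) (X : vfield) p : (h *: X) p = h p *: X p.
Proof. by []. Qed.

Fact bracket_derivation (X Y : vfield) p :
  (fun f => X p (vder Y f) - Y p (vder X f)) \in @derivation_at p.
Proof.
have vderL (Z : vfield) a f g : vder Z (a *: f + g) = a *: vder Z f + vder Z g.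
  apply: val_inj; apply/funext => q.
  by have /asboolP[+ _] := tangentP (Z q); exact.
have vderM (Z : vfield) f g : vder Z (f * g) = vder Z f * g + f * vder Z g.
  apply: val_inj; apply/funext => q.
  by have /asboolP[_ +] := tangentP (Z q); exact.
have /asboolP[XL XM] := tangentP (X p).
have /asboolP[YL YM] := tangentP (Y p).
have XD f g : X p (f + g) = X p f + X p g.
  by have := XL 1 f g; rewrite scale1r mul1r.
have YD f g : Y p (f + g) = Y p f + Y p g.
  by have := YL 1 f g; rewrite scale1r mul1r.
apply/asboolP; split=> [a f g|f g].
  by rewrite !vderL XL YL; ring.
rewrite !vderM XD YD !XM !YM /=; ring.
Qed.

Fact bracket_smooth (X Y : vfield) (f : smooth_fun M) :
  (fun p => Tangent (bracket_derivation X Y p) f) \in @smooth_fun_pred R n M.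
Proof. exact: smooth_funP (vder X (vder Y f) - vder Y (vder X f)). Qed.

Definition bracket (X Y : vfield) : vfield := VField (bracket_smooth X Y).

End TangentSpaces.

Section Tensors.
Variables (R : realType) (n : nat) (M : manifold R n).

(* Tensor fields are families of (multi)linear maps on the tangent spaces; the
   smoothness clause says that they send smooth fields to smooth objects. *)
Record one_form := OneForm {
  one_form_val :> forall p : M, {linear tangent p -> R};
  one_form_smooth : forall X : vfield M,
    (fun p => one_form_val p (X p)) \in @smooth_fun_pred R n M
}.

Record tensor11 := Tensor11 {
  tensor11_val :> forall p : M, {linear tangent p -> tangent p};
  tensor11_smooth : forall (X : vfield M) (f : smooth_fun M),
    (fun p => tensor11_val p (X p) f) \in @smooth_fun_pred R n M
}.

Record metric := Metric {
  metric_val :> forall p : M, tangent p -> tangent p -> R;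
  metric_linear : forall p (a : R) (u v w : tangent p),
    metric_val (a *: u + v) w = a * metric_val u w + metric_val v w;
  metric_sym : forall p (u v : tangent p), metric_val u v = metric_val v u;
  metric_pos : forall p (u : tangent p), u != 0 -> 0 < metric_val u u;
  metric_smooth : forall X Y : vfield M,
    (fun p => metric_val (X p) (Y p)) \in @smooth_fun_pred R n M
}.

Definition form_app (eta : one_form) (X : vfield M) : smooth_fun M :=
  SmoothFun (one_form_smooth eta X).

Definition tensor_app (phi : tensor11) (X : vfield M) : vfield M :=
  VField (tensor11_smooth phi X).

Definition metric_app (g : metric) (X Y : vfield M) : smooth_fun M :=
  SmoothFun (metric_smooth g X Y).

Definition metric_norm (g : metric) (p : M) (u : tangent p) : R :=
  Num.sqrt (g p u u).

Definition is_levi_civita (g : metric)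
    (nabla : vfield M -> vfield M -> vfield M) : Prop :=
  [/\ forall (f : smooth_fun M) (X Y Z : vfield M),
        nabla (f *: X + Y) Z = f *: nabla X Z + nabla Y Z,
      forall X Y Z : vfield M, nabla X (Y + Z) = nabla X Y + nabla X Z,
      forall (f : smooth_fun M) (X Y : vfield M),
        nabla X (f *: Y) = vder X f *: Y + f *: nabla X Y,
      forall X Y : vfield M, nabla X Y - nabla Y X = bracket X Y
    & forall X Y Z : vfield M, vder X (metric_app g Y Z) =
        metric_app g (nabla X Y) Z + metric_app g Y (nabla X Z)].

(* exterior derivatives, without the factors 1/2 and 1/3 used by some authors *)
Definition ext_d1 (eta : one_form) (X Y : vfield M) : smooth_fun M :=
  vder X (form_app eta Y) - vder Y (form_app eta X)
  - form_app eta (bracket X Y).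

Definition ext_d2 (Phi : vfield M -> vfield M -> smooth_fun M)
    (X Y Z : vfield M) : smooth_fun M :=
  vder X (Phi Y Z) - vder Y (Phi X Z) + vder Z (Phi X Y)
  - Phi (bracket X Y) Z + Phi (bracket X Z) Y - Phi (bracket Y Z) X.

(* [phi, phi](X, Y) *)
Definition nijenhuis (phi : tensor11) (X Y : vfield M) : vfield M :=
  tensor_app phi (tensor_app phi (bracket X Y))
  + bracket (tensor_app phi X) (tensor_app phi Y)
  - tensor_app phi (bracket (tensor_app phi X) Y)
  - tensor_app phi (bracket X (tensor_app phi Y)).

Definition is_almost_contact_metric (phi : tensor11) (xi : vfield M)
    (eta : one_form) (g : metric) : Prop :=
  forall p : M,
  [/\ forall u : tangent p, phi p (phi p u) = - u + eta p u *: xi p,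
      phi p (xi p) = 0,
      forall u : tangent p, eta p (phi p u) = 0,
      eta p (xi p) = 1
    & (forall u v : tangent p,
        g p (phi p u) (phi p v) = g p u v - eta p u * eta p v)
      /\ (forall u : tangent p, eta p u = g p u (xi p))].

Definition fundamental_form (phi : tensor11) (g : metric) (X Y : vfield M) :
  smooth_fun M := metric_app g X (tensor_app phi Y).

(* With d eta normalised as in [ext_d1], the second term of the normality
   condition is d eta (x) xi, often written 2 d eta (x) xi. *)
Definition is_normal (phi : tensor11) (xi : vfield M) (eta : one_form) : Prop :=
  forall X Y : vfield M, nijenhuis phi X Y + ext_d1 eta X Y *: xi = 0.

Definition is_cosymplectic (phi : tensor11) (xi : vfield M) (eta : one_form)
    (g : metric) : Prop :=
  [/\ is_almost_contact_metric phi xi eta g,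
      is_normal phi xi eta,
      forall X Y : vfield M, ext_d1 eta X Y = 0
    & forall X Y Z : vfield M, ext_d2 (fundamental_form phi g) X Y Z = 0].

End Tensors.

(* Smooth maps are morphisms of ringed spaces: pulling back along F preserves
   smoothness of functions on open sets. *)
Record smooth_map (R : realType) (m n : nat) (M : manifold R m)
    (N : manifold R n) := SmoothMap {
  smooth_map_val :> M -> N;
  smooth_map_continuous : continuous smooth_map_val;
  smooth_map_pullback : forall (W : set N) (f : N -> R), open W ->
    smooth_on W f -> smooth_on (smooth_map_val @^-1` W) (f \o smooth_map_val)
}.

Section Submersions.
Variables (R : realType) (m n : nat) (M : manifold R m) (N : manifold R n).
Implicit Type F : smooth_map M N.

Fact pullback_smooth F (f : smooth_fun N) :
  (f \o F : M -> R) \in @smooth_fun_pred R m M.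
Proof.
apply/asboolP; have /asboolP sf := smooth_funP f.
exact: (@smooth_map_pullback _ _ _ _ _ F _ _ openT sf).
Qed.

Definition pullback F (f : smooth_fun N) : smooth_fun M :=
  SmoothFun (pullback_smooth F f).

Fact differential_derivation F (p : M) (v : tangent p) :
  (fun f => v (pullback F f)) \in @derivation_at R n N (F p).
Proof.
have /asboolP[vL vM] := tangentP v.
apply/asboolP; split=> [a f g|f g].
  by rewrite -vL; congr (v _); exact: val_inj.
rewrite -[f (F p)]/(pullback F f p) -[g (F p)]/(pullback F g p) -vM.
by congr (v _); exact: val_inj.
Qed.

Definition differential F (p : M) (v : tangent p) : tangent (F p) :=
  Tangent (differential_derivation F v).

Definition is_vertical_at F (p : M) (v : tangent p) : Prop :=
  differential F v = 0.

Definition is_horizontal_at (g : metric M) F (p : M) (v : tangent p) : Prop :=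
  forall w : tangent p, is_vertical_at F w -> g p v w = 0.

Definition is_vertical F (X : vfield M) : Prop :=
  forall p : M, is_vertical_at F (X p).

Definition is_horizontal (g : metric M) F (X : vfield M) : Prop :=
  forall p : M, is_horizontal_at g F (X p).

Definition is_riemannian_submersion (gM : metric M) (gN : metric N) F : Prop :=
  [/\ forall q : N, exists p : M, F p = q,
      forall (p : M) (w : tangent (F p)),
        exists v : tangent p, differential F v = w
    & forall (p : M) (v : tangent p), is_horizontal_at gM F v ->
        metric_norm gN (differential F v) = metric_norm gM v].

(* ver is the orthogonal projection of TM onto the vertical distribution. It is
   determined pointwise, and its smoothness is automatic for a submersion. *)
Definition is_vertical_projection (g : metric M) F (ver : tensor11 M) : Prop :=
  forall (p : M) (v : tangent p),
    is_vertical_at F (ver p v) /\ is_horizontal_at g F (v - ver p v).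

(* The angle between a nonzero tangent vector v and ker F_*, i.e. between v and
   its orthogonal projection on ker F_*; it lies in [0, pi/2]. *)
Definition angle_to_vertical (g : metric M) (ver : tensor11 M) (p : M)
    (v : tangent p) : R :=
  acos (metric_norm g (ver p v) / metric_norm g v).

(* theta = 0, i.e. phi-invariant fibres, is allowed here. *)
Definition is_slant (g : metric M) (phi : tensor11 M) (xi : vfield M) F
    (ver : tensor11 M) (theta : R) : Prop :=
  0 <= theta <= pi / 2 /\
  forall (p : M) (v : tangent p), is_vertical_at F v -> v != 0 ->
    (forall a : R, v <> a *: xi p) ->
    angle_to_vertical g ver (phi p v) = theta.

(* D is a distribution given through its sections. For a torsion-free nabla this
   includes involutivity: [X, Y] = nabla X Y - nabla Y X. *)
Definition totally_geodesic_foliation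
    (nabla : vfield M -> vfield M -> vfield M) (D : vfield M -> Prop) : Prop :=
  forall X Y : vfield M, D X -> D Y -> D (nabla X Y).

Section Components.
Variables (nabla : vfield M -> vfield M -> vfield M).
Variables (phi ver : tensor11 M).

Definition verproj (X : vfield M) : vfield M := tensor_app ver X.
Definition horproj (X : vfield M) : vfield M := X - verproj X.

Definition psi (U : vfield M) : vfield M := verproj (tensor_app phi U).
Definition omega (U : vfield M) : vfield M := horproj (tensor_app phi U).
Definition calB (X : vfield M) : vfield M := verproj (tensor_app phi X).
Definition calC (X : vfield M) : vfield M := horproj (tensor_app phi X).

Definition oneill_T (E G : vfield M) : vfield M :=
  horproj (nabla (verproj E) (verproj G))
  + verproj (nabla (verproj E) (horproj G)).

End Components.

End Submersions.

(* Main.v *)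
Require Import Defs.
From mathcomp Require Import all_boot all_order all_algebra.
From mathcomp Require Import all_classical all_reals all_analysis.
From mathcomp Require Import lra.

(* For U, V vertical and X horizontal, [slant_second_fundamental_form] reads
   sin^2(theta) g(nabla_U V, X) =
     g(nabla_U omega V, phi X) - g(nabla_U omega psi V, X).
   It follows from nabla phi = 0 and nabla xi = 0 by writing phi = psi + omega
   twice and using psi^2 V = - cos^2(theta) (V - eta(V) xi), which is the slant
   condition polarised. Splitting phi X = B X + C X turns the right-hand side
   into the difference of the two sides of the stated condition, and
   sin(theta) <> 0. *)

Set Implicit Arguments.
Unset Strict Implicit.
Unset Printing Implicit Defensive.

Import Order.TTheory GRing.Theory Num.Theory.
Import numFieldNormedType.Exports.

Local Open Scope classical_set_scope.
Local Open Scope ring_scope.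

(** * Pointwise bilinear algebra of a Riemannian metric *)

Section MetricAlgebra.
Variables (R : realType) (n : nat) (M : manifold R n) (g : metric M) (p : M).
Implicit Types u v w : tangent p.

Lemma metricDl u v w : g p (u + v) w = g p u w + g p v w.
Proof. by rewrite -[u]scale1r metric_linear mul1r scale1r. Qed.

Lemma metric0l w : g p 0 w = 0.
Proof. by have := metricDl 0 0 w; rewrite addr0; lra. Qed.

Lemma metricZl a u w : g p (a *: u) w = a * g p u w.
Proof. by rewrite -[a *: u]addr0 metric_linear metric0l addr0. Qed.

Lemma metricNl u w : g p (- u) w = - g p u w.
Proof. by rewrite -scaleN1r metricZl mulN1r. Qed.

Lemma metricDr u v w : g p w (u + v) = g p w u + g p w v.
Proof. by rewrite !(Defs.metric_sym g w) metricDl. Qed.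

Lemma metric0r w : g p w 0 = 0.
Proof. by rewrite Defs.metric_sym metric0l. Qed.

Lemma metricZr a u w : g p w (a *: u) = a * g p w u.
Proof. by rewrite !(Defs.metric_sym g w) metricZl. Qed.

Lemma metricNr u w : g p w (- u) = - g p w u.
Proof. by rewrite !(Defs.metric_sym g w) metricNl. Qed.

Definition metricE := (metricDl, metricDr, metricNl, metricNr,
  metricZl, metricZr, metric0l, metric0r).

Lemma metric_eq0 u : g p u u = 0 -> u = 0.
Proof.
by move=> u0; apply: contra_eq u0 => /(metric_pos g) /lt0r_neq0.
Qed.

Lemma metric_ge0 u : 0 <= g p u u.
Proof. by have [->|/(metric_pos g)/ltW//] := eqVneq u 0; rewrite metric0l. Qed.

End MetricAlgebra.

Lemma tangentD (R : realType) (n : nat) (M : manifold R n) (p : M)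
  (v : tangent p) (f h : smooth_fun M) : v (f + h) = v f + v h.
Proof.
by have /asboolP[/(_ 1 f h) + _] := tangentP v; rewrite scale1r mul1r.
Qed.

Lemma tangent0 (R : realType) (n : nat) (M : manifold R n) (p : M)
  (v : tangent p) : v 0 = 0.
Proof. by have := tangentD v 0 0; rewrite addr0; lra. Qed.

Lemma tensor_appE (R : realType) (n : nat) (M : manifold R n)
  (t : tensor11 M) (X : vfield M) p : tensor_app t X p = t p (X p).
Proof. by []. Qed.

Lemma tensorB (R : realType) (n : nat) (M : manifold R n) (t : tensor11 M)
  (p : M) (u v : tangent p) : t p (u - v) = t p u - t p v.
Proof. exact: raddfB. Qed.

(** * The Levi-Civita connection, evaluated at points *)

Section LeviCivita.
Variables (R : realType) (n : nat) (M : manifold R n) (g : metric M).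
Variable nabla : vfield M -> vfield M -> vfield M.
Hypothesis lc : is_levi_civita g nabla.
Implicit Types (X Y Z : vfield M) (f : smooth_fun M) (p : M).

Lemma nablaDr X Y Z : nabla X (Y + Z) = nabla X Y + nabla X Z.
Proof. by case: lc. Qed.

Lemma nabla0r X : nabla X 0 = 0.
Proof. by apply: (addrI (nabla X 0)); rewrite -nablaDr !addr0. Qed.

Lemma nablaNr X Y : nabla X (- Y) = - nabla X Y.
Proof. by apply: (addrI (nabla X Y)); rewrite -nablaDr !subrr nabla0r. Qed.

Lemma nablaZr X f Y p : nabla X (f *: Y) p = X p f *: Y p + f p *: nabla X Y p.
Proof. by case: lc => _ _ -> _ _. Qed.

Lemma nabla_torsion X Y p : bracket X Y p = nabla X Y p - nabla Y X p.
Proof. by case: lc => _ _ _ <- _. Qed.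

Lemma nabla_metric X Y Z p : X p (metric_app g Y Z) =
  g p (nabla X Y p) (Z p) + g p (Y p) (nabla X Z p).
Proof.
by case: lc => _ _ _ _ /(_ X Y Z)/(congr1 (fun f : smooth_fun M => f p)).
Qed.

End LeviCivita.

(** * Cosymplectic structures: [phi] and [xi] are parallel *)

Section Cosymplectic.
Variables (R : realType) (n : nat) (M : manifold R n) (g : metric M).
Variables (phi : tensor11 M) (xi : vfield M) (eta : one_form M).
Variable nabla : vfield M -> vfield M -> vfield M.
Hypothesis cs : is_cosymplectic phi xi eta g.
Hypothesis lc : is_levi_civita g nabla.
Implicit Types (X Y Z W : vfield M) (p : M).

Let acm : is_almost_contact_metric phi xi eta g. Proof. by case: cs. Qed.

Lemma phi2 p (u : tangent p) : phi p (phi p u) = - u + eta p u *: xi p.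
Proof. by have [] := acm p. Qed.

Lemma phi_xi p : phi p (xi p) = 0.
Proof. by have [] := acm p. Qed.

Lemma eta_phi p (u : tangent p) : eta p (phi p u) = 0.
Proof. by have [] := acm p. Qed.

Lemma eta_xi p : eta p (xi p) = 1.
Proof. by have [] := acm p. Qed.

Lemma metric_phi p (u v : tangent p) :
  g p (phi p u) (phi p v) = g p u v - eta p u * eta p v.
Proof. by have [_ _ _ _ []] := acm p. Qed.

Lemma metric_xi p (u : tangent p) : g p u (xi p) = eta p u.
Proof. by have [_ _ _ _ [_ ->]] := acm p. Qed.

(** Metric compatibility applied to [u] and [phi v]; the [xi] term of [phi^2 v] drops out since
    g(phi u, xi) = eta(phi u) = 0. *)
Lemma phi_skew p (u v : tangent p) : g p (phi p u) v = - g p u (phi p v).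
Proof.
have := metric_phi u (phi p v); rewrite phi2 eta_phi mulr0 subr0 !metricE.
by rewrite metric_xi eta_phi mulr0 addr0 => <-; rewrite opprK.
Qed.

Lemma phi2_field Y : tensor_app phi (tensor_app phi Y) =
  - Y + form_app eta Y *: xi.
Proof. by apply: vfield_eqP => p; exact: phi2. Qed.

Lemma form_app_metric Y : form_app eta Y = metric_app g Y xi.
Proof. by apply: val_inj; apply/funext => p /=; rewrite metric_xi. Qed.

(** This is d eta = 0: metric compatibility and vanishing torsion turn [ext_d1 eta X Y] into the
    difference of the two sides. *)
Lemma metric_nabla_xi_sym X Y p :
  g p (nabla X xi p) (Y p) = g p (nabla Y xi p) (X p).
Proof.
case: cs => _ _ /(_ X Y)/(congr1 (fun f : smooth_fun M => f p)) + _.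
rewrite -[LHS]/(X p (form_app eta Y) - Y p (form_app eta X)
  - eta p (bracket X Y p)) -[RHS]/0 !form_app_metric !(nabla_metric lc).
rewrite -metric_xi (nabla_torsion lc) !metricE.
by rewrite (Defs.metric_sym g (Y p)) (Defs.metric_sym g (X p)); lra.
Qed.

Definition nabla_phi X Y : vfield M :=
  nabla X (tensor_app phi Y) - tensor_app phi (nabla X Y).

(** [A] is (nabla_X Phi)(Y, Z) for the fundamental form Phi, and [a] is (nabla_X eta)(Y). *)
Let A X Y Z p := g p (Y p) (nabla_phi X Z p).
Let a X Y p := g p (nabla X xi p) (Y p).

Let AE X Y Z p : A X Y Z p =
  g p (Y p) (nabla X (tensor_app phi Z) p) - g p (Y p) (phi p (nabla X Z p)).
Proof. by rewrite /A /nabla_phi vfieldDE vfieldNE !metricE. Qed.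

(** Differentiate g(Y, phi Z) + g(phi Y, Z) = 0 along [X]. *)
Let A_skew X Y Z p : A X Y Z p = - A X Z Y p.
Proof.
have e : metric_app g Y (tensor_app phi Z) + metric_app g (tensor_app phi Y) Z = 0.
  by apply: val_inj; apply/funext => q /=; rewrite fctE phi_skew subrr.
have := tangent0 (X p); rewrite -e tangentD !(nabla_metric lc) !AE /=.
have := phi_skew (nabla X Y p) (Z p); have := phi_skew (Y p) (nabla X Z p).
rewrite (Defs.metric_sym g (phi p (nabla X Y p))).
by rewrite (Defs.metric_sym g (nabla X (tensor_app phi Y) p)); lra.
Qed.

(** For a torsion-free connection the cyclic sum of nabla Phi is dPhi, which vanishes here. *)
Let A_cyclic X Y Z p : A X Y Z p + A Y Z X p + A Z X Y p = 0.
Proof.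
case: cs => _ _ _ /(_ X Y Z)/(congr1 (fun f : smooth_fun M => f p)).
rewrite -[LHS]/(X p (metric_app g Y (tensor_app phi Z))
  - Y p (metric_app g X (tensor_app phi Z))
  + Z p (metric_app g X (tensor_app phi Y))
  - g p (bracket X Y p) (phi p (Z p)) + g p (bracket X Z p) (phi p (Y p))
  - g p (bracket Y Z p) (phi p (X p))) -[RHS]/0.
rewrite !(nabla_metric lc) !(nabla_torsion lc) !metricE /=.
have s U V W : g p (nabla U V p) (phi p (W p)) = - g p (W p) (phi p (nabla U V p)).
  by rewrite -phi_skew Defs.metric_sym.
(* [ext_d2] differentiates Phi(X, Z) along [Y]; skewness turns the resulting [A Y X Z] into the
   cyclic term. *)
have := A_skew Y X Z p; rewrite !AE !s; lra.
Qed.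

(** The covariant derivative of phi^2 = - I + eta (x) xi, expanded by the Leibniz rule and paired
    with [W]; skewness moves the outer [phi] onto [W]. *)
Let phi_A X Y W p : A X W (tensor_app phi Y) p =
  A X (tensor_app phi W) Y p + a X Y p * eta p (W p) + eta p (Y p) * a X W p.
Proof.
rewrite !AE /a phi2_field (nablaDr lc) (nablaNr lc).
rewrite vfieldDE vfieldNE (nablaZr lc) form_app_metric (nabla_metric lc) /=.
rewrite !phi_skew !phi2 !metricE !metric_xi.
rewrite (Defs.metric_sym g (W p) (nabla X xi p)).
rewrite (Defs.metric_sym g (Y p) (nabla X xi p)).
lra.
Qed.

(** Differentiate g(phi Z, xi) = 0 along [X]. *)
Let A_xi X Z p : A X xi Z p = - a X (tensor_app phi Z) p.
Proof.
have e : metric_app g (tensor_app phi Z) xi = 0.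
  by apply: val_inj; apply/funext => q /=; rewrite metric_xi eta_phi.
have := tangent0 (X p); rewrite -e (nabla_metric lc) AE /a /=.
rewrite !(Defs.metric_sym g (xi p)) !metric_xi eta_phi.
by rewrite !(Defs.metric_sym g _ (nabla X _ p)); lra.
Qed.

(** Normality and d eta = 0 make the Nijenhuis tensor vanish. Vanishing torsion rewrites it at (Y,
    Z) as (nabla_{phi Y} phi) Z - (nabla_{phi Z} phi) Y + phi (nabla_Z phi) Y - phi (nabla_Y phi) Z,
    which is then paired with [phi X]. *)
Let A_nijenhuis X Y Z p :
  A (tensor_app phi Y) (tensor_app phi X) Z p
  - A (tensor_app phi Z) (tensor_app phi X) Y p
  + (A Z X Y p - eta p (X p) * A Z xi Y p)
  - (A Y X Z p - eta p (X p) * A Y xi Z p) = 0.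
Proof.
have AP U V : A U X V p - eta p (X p) * A U xi V p =
    g p (phi p (X p)) (phi p (nabla_phi U V p)).
  by rewrite metric_phi /A (Defs.metric_sym g (xi p)) metric_xi.
case: cs => _ /(_ Y Z)/(congr1 (fun W : vfield M => W p)) + dE _; rewrite dE.
rewrite scale0r addr0 => /(congr1 (g p (phi p (X p)))).
rewrite !AP /A /nabla_phi /nijenhuis.
rewrite !(vfieldDE, vfieldNE, tensor_appE) vfield0E !(nabla_torsion lc).
rewrite !tensorB !metricE; lra.
Qed.

(* Blair's argument: in dPhi(X, phi Y, phi Z) - dPhi(X, Y, Z)
   + g(N(Y, Z), phi X), where N is the Nijenhuis tensor of phi, everything
   cancels except - 2 g(Y, (nabla_X phi) Z), since nabla eta is symmetric. *)
Let A_eq0 X Y Z p : A X Y Z p = 0.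
Proof.
have phi2A : A X (tensor_app phi (tensor_app phi Y)) Z p =
    - A X Y Z p + eta p (Y p) * A X xi Z p.
  by rewrite /A !tensor_appE phi2 !metricE mulrBr.
have := A_nijenhuis X Y Z p.
have := A_cyclic X (tensor_app phi Y) (tensor_app phi Z) p.
have := A_cyclic X Y Z p; have := A_skew Y X Z p.
have := A_skew (tensor_app phi Y) (tensor_app phi X) Z p.
have := phi_A (tensor_app phi Y) X Z p; have := phi_A (tensor_app phi Z) Y X p.
have := phi_A X Z (tensor_app phi Y) p; rewrite phi2A !A_xi tensor_appE eta_phi.
have a_sym U V : a U V p = a V U p by exact: metric_nabla_xi_sym.
rewrite !(a_sym X (tensor_app _ _)) (a_sym Z) (a_sym Y).
lra.
Qed.

Lemma nabla_phi_eq0 X Y : nabla_phi X Y = 0.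
Proof. by apply: vfield_eqP => p; apply: metric_eq0; exact: A_eq0. Qed.

Lemma nabla_phiC X Y : nabla X (tensor_app phi Y) = tensor_app phi (nabla X Y).
Proof. exact/subr0_eq/nabla_phi_eq0. Qed.

(** Differentiating phi xi = 0 and g(xi, xi) = 1 shows that both [phi] and [eta] kill [nabla X xi];
    the formula for phi^2 then makes it zero. *)
Lemma nabla_xi_eq0 X : nabla X xi = 0.
Proof.
apply: vfield_eqP => p; rewrite vfield0E.
have phi_xi0 : tensor_app phi xi = 0 by apply: vfield_eqP => q; exact: phi_xi.
have phin : phi p (nabla X xi p) = 0.
  have := congr1 (fun W : vfield M => W p) (nabla_phiC X xi).
  by rewrite phi_xi0 (nabla0r lc) /= => <-.
have eta1 : metric_app g xi xi = 1.
  by apply: val_inj; apply/funext => q /=; rewrite metric_xi eta_xi.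
have etan : eta p (nabla X xi p) = 0.
  (* A derivation kills constants: 1 * 1 = 1 gives X(1) = 2 X(1). *)
  have X1 : X p 1 = 0.
    have /asboolP[_ /(_ 1 1)] := tangentP (X p); rewrite mulr1.
    rewrite -[(1 : smooth_fun M) p]/(1 : R); lra.
  have := nabla_metric lc X xi xi p; rewrite eta1 X1.
  by rewrite (Defs.metric_sym g (xi p)) metric_xi; lra.
have := phi2 (nabla X xi p); rewrite phin etan scale0r addr0 raddf0.
by move=> /esym/eqP; rewrite oppr_eq0 => /eqP.
Qed.

End Cosymplectic.

(** * The vertical distribution and its orthogonal projection *)

Section VerticalDistribution.
Variables (R : realType) (m n : nat) (M : manifold R m) (N : manifold R n).
Variables (g : metric M) (F : smooth_map M N) (ver : tensor11 M).
Hypothesis verP : is_vertical_projection g F ver.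
Implicit Types (p : M) (X U V : vfield M).

Lemma vertical_atD p (u v : tangent p) :
  is_vertical_at F u -> is_vertical_at F v -> is_vertical_at F (u + v).
Proof.
move=> Fu Fv; rewrite /is_vertical_at -[RHS]addr0 -{1}Fu -Fv.
exact: val_inj.
Qed.

Lemma vertical_atZ p a (u : tangent p) :
  is_vertical_at F u -> is_vertical_at F (a *: u).
Proof.
move=> Fu; rewrite /is_vertical_at -(scaler0 _ a) -Fu.
exact: val_inj.
Qed.

Lemma ver_vertical p (u : tangent p) : is_vertical_at F (ver p u).
Proof. by have [] := verP u. Qed.

Lemma sub_ver_horizontal p (u : tangent p) : is_horizontal_at g F (u - ver p u).
Proof. by have [] := verP u. Qed.

Lemma metric_ver p (u w : tangent p) : is_vertical_at F w ->
  g p (ver p u) w = g p u w.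
Proof.
by move=> /(@sub_ver_horizontal p u); rewrite !metricE; lra.
Qed.

(** The difference [u - ver p u] is both vertical and horizontal, hence orthogonal to itself. *)
Lemma ver_id p (u : tangent p) : is_vertical_at F u -> ver p u = u.
Proof.
move=> Fu; apply/esym/subr0_eq/(metric_eq0 (g := g)).
apply: sub_ver_horizontal; apply: vertical_atD => //.
by rewrite -scaleN1r; apply: vertical_atZ; exact: ver_vertical.
Qed.

Lemma ver_horizontal p (u : tangent p) : is_horizontal_at g F u -> ver p u = 0.
Proof.
move=> hu; apply: (metric_eq0 (g := g)).
by rewrite metric_ver; [exact/hu/ver_vertical|exact: ver_vertical].
Qed.

(** The gap is the squared length of the horizontal part. This keeps the quotient inside [acos] at
    most 1. *)
Lemma metric_ver_le p (u : tangent p) : g p (ver p u) (ver p u) <= g p u u.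
Proof.
have := metric_ge0 g (u - ver p u); rewrite !metricE.
have := metric_ver u (ver_vertical u).
by rewrite (Defs.metric_sym g (ver p u) u); lra.
Qed.

Lemma metric_split p (u w : tangent p) :
  g p u w = g p (ver p u) (ver p w) + g p (u - ver p u) (w - ver p w).
Proof.
have := sub_ver_horizontal u (ver_vertical w).
have := sub_ver_horizontal w (ver_vertical u).
rewrite Defs.metric_sym !metricE; lra.
Qed.

End VerticalDistribution.

(** * The slant condition and psi^2 on vertical vectors *)

Section Slant.
Variables (R : realType) (m n : nat) (M : manifold R m) (N : manifold R n).
Variables (g : metric M) (phi : tensor11 M) (xi : vfield M) (eta : one_form M).
Variables (F : smooth_map M N) (ver : tensor11 M) (theta : R).
Hypothesis cs : is_cosymplectic phi xi eta g.
Hypothesis verP : is_vertical_projection g F ver.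
Hypothesis Fxi : is_vertical F xi.
Hypothesis sl : is_slant g phi xi F ver theta.
Implicit Types p : M.

Let eta_metric p (u : tangent p) : eta p u = g p u (xi p).
Proof. by rewrite (metric_xi cs). Qed.

Lemma metric_norm_sqr p (u : tangent p) : metric_norm g u ^+ 2 = g p u u.
Proof. by rewrite sqr_sqrtr// metric_ge0. Qed.

Lemma slant_norm p (u : tangent p) : is_vertical_at F u ->
  g p (ver p (phi p u)) (ver p (phi p u)) =
  cos theta ^+ 2 * (g p u u - eta p u ^+ 2).
Proof.
move=> Fu; rewrite [eta p u ^+ 2]expr2 -(metric_phi cs).
(* If phi u = 0 both sides vanish. Otherwise [u] is neither zero nor a multiple of [xi], so the
   slant condition applies to it. *)
have [phi0|phi_neq0] := eqVneq (phi p u) 0.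
  by rewrite phi0 [ver p 0]raddf0 metric0l mulr0.
have nmul a : u <> a *: xi p.
  move=> uE; move: phi_neq0.
  by rewrite uE [phi p _]linearZ /= (phi_xi cs) [_ *: _]scaler0 eqxx.
have u_neq0 : u != 0.
  by apply/eqP => u0; apply: (nmul 0); rewrite scale0r.
have norm_gt0 : 0 < metric_norm g (phi p u).
  by rewrite sqrtr_gt0; exact: metric_pos.
have [_ /(_ p u Fu u_neq0 nmul) <-] := sl.
rewrite acosK; last first.
  rewrite in_itv /=; apply/andP; split.
    by rewrite (@le_trans _ _ 0)// ?lerN10// divr_ge0// sqrtr_ge0.
  by rewrite ler_pdivrMr// mul1r ler_wsqrtr// (metric_ver_le verP).
rewrite expr_div_n !metric_norm_sqr divfK//.
by rewrite gt_eqF//; exact: metric_pos.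
Qed.

(** Polarisation of [slant_norm]. *)
Lemma slant_metric p (u v : tangent p) :
  is_vertical_at F u -> is_vertical_at F v ->
  g p (ver p (phi p u)) (ver p (phi p v)) =
  cos theta ^+ 2 * (g p u v - eta p u * eta p v).
Proof.
move=> Fu Fv; have := slant_norm (vertical_atD Fu Fv).
rewrite [phi p (u + v)]raddfD [ver p (_ + _)]raddfD [eta p (u + v)]raddfD /=.
rewrite !metricE (Defs.metric_sym g v u).
rewrite (Defs.metric_sym g (ver p (phi p v)) (ver p (phi p u))).
have := slant_norm Fu; have := slant_norm Fv; lra.
Qed.

Lemma slant_psi2 p (v : tangent p) : is_vertical_at F v ->
  ver p (phi p (ver p (phi p v))) =
  - cos theta ^+ 2 *: (v - eta p v *: xi p).
Proof.
move=> Fv; set c := cos theta ^+ 2; set w := ver p _.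
(* Since g(psi v, psi z) = - g(psi^2 v, z), the polarised condition says that the difference of the
   two sides is orthogonal to every vertical [z]. *)
have ort z : is_vertical_at F z -> g p (w + c *: (v - eta p v *: xi p)) z = 0.
  move=> Fz; have := slant_metric Fv Fz.
  have -> : g p (ver p (phi p v)) (ver p (phi p z)) = - g p w z.
    rewrite (metric_ver verP (phi p (ver p (phi p v))) Fz) (phi_skew cs) opprK.
    rewrite Defs.metric_sym (metric_ver verP); last exact: (ver_vertical verP).
    by rewrite Defs.metric_sym.
  by rewrite -/c !metricE (Defs.metric_sym g (xi p)) -eta_metric; lra.
apply: subr0_eq; rewrite scaleNr opprK; apply: (metric_eq0 (g := g)).
(* The difference is itself vertical, because [xi] is, so it is orthogonal to itself. *)
apply: ort; apply: vertical_atD; first exact: (ver_vertical verP).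
apply: vertical_atZ; apply: vertical_atD => //.
by rewrite -scaleNr; apply: vertical_atZ; exact: Fxi.
Qed.

End Slant.

(** * The second fundamental form of the fibres *)

Section SecondFundamentalForm.
Variables (R : realType) (m n : nat) (M : manifold R m) (N : manifold R n).
Variables (g : metric M) (phi : tensor11 M) (xi : vfield M) (eta : one_form M).
Variable nabla : vfield M -> vfield M -> vfield M.
Variables (F : smooth_map M N) (ver : tensor11 M) (theta : R).
Hypothesis cs : is_cosymplectic phi xi eta g.
Hypothesis lc : is_levi_civita g nabla.
Hypothesis verP : is_vertical_projection g F ver.
Hypothesis Fxi : is_vertical F xi.
Hypothesis sl : is_slant g phi xi F ver theta.
Implicit Types (p : M) (X U V W : vfield M).

Lemma verprojD_horproj W : W = verproj ver W + horproj ver W.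
Proof. by rewrite /horproj addrC subrK. Qed.

Lemma metric_horproj W X p : is_horizontal g F X ->
  g p (horproj ver W p) (X p) = g p (W p) (X p).
Proof.
move=> hX; rewrite [in RHS](verprojD_horproj W) vfieldDE metricDl.
rewrite (Defs.metric_sym g (verproj ver W p)) hX ?add0r//.
exact: (ver_vertical verP).
Qed.

(** As [W] has no vertical part, only the second term of the tensor survives. *)
Lemma oneill_T_vertical_horizontal U W :
  is_vertical F U -> is_horizontal g F W ->
  oneill_T nabla ver U W = verproj ver (nabla U W).
Proof.
move=> FU hW; rewrite /oneill_T.
have -> : verproj ver U = U by apply: vfield_eqP => p; exact: (ver_id verP).
rewrite /horproj; have -> : verproj ver W = 0.
  by apply: vfield_eqP => p; exact: (ver_horizontal verP).
rewrite (nabla0r lc) subr0; have -> : verproj ver 0 = 0.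
  by apply: vfield_eqP => p; rewrite /verproj tensor_appE raddf0.
by rewrite subr0 add0r.
Qed.

(** The Leibniz term U(f) V is vertical, so the horizontal part of [nabla U V] is tensorial in
    [V]. *)
Lemma nablaZ_metric U V X (f : smooth_fun M) p :
  is_vertical F V -> is_horizontal g F X ->
  g p (nabla U (f *: V) p) (X p) = f p * g p (nabla U V p) (X p).
Proof.
move=> FV hX; rewrite (nablaZr lc) !metricE (Defs.metric_sym g (V p)).
by rewrite hX ?mulr0 ?add0r.
Qed.

Lemma slant_second_fundamental_form U V X p :
  is_vertical F V -> is_horizontal g F X ->
  sin theta ^+ 2 * g p (nabla U V p) (X p) =
  g p (nabla U (omega phi ver V) p) (phi p (X p))
  - g p (nabla U (omega phi ver (psi phi ver V)) p) (X p).
Proof.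
move=> FV hX.
have etaX : eta p (X p) = 0 by rewrite -(metric_xi cs) hX//; exact: Fxi.
(* The constant is taken as a smooth function because vector fields form a module over
   [smooth_fun M]; [nablaZ_metric] can then pull it out of [nabla]. *)
pose c : smooth_fun M := - cos theta ^+ 2 *: (1 : smooth_fun M).
have cE q : c q = - cos theta ^+ 2 by exact: mulr1.
have psi2 : psi phi ver (psi phi ver V) = c *: (V - form_app eta V *: xi).
  apply: vfield_eqP => q; rewrite vfieldZE cE.
  exact: (slant_psi2 cs verP Fxi sl (FV q)).
have Fd : is_vertical F (V - form_app eta V *: xi).
  move=> q; apply: vertical_atD; first exact: FV.
  rewrite vfieldNE -scaleN1r; apply: vertical_atZ; apply: vertical_atZ; exact: Fxi.
have phiE W : nabla U (psi phi ver W) p + nabla U (omega phi ver W) p =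
    phi p (nabla U W p).
  rewrite -tensor_appE -(nabla_phiC cs lc).
  by rewrite (verprojD_horproj (tensor_app phi W)) (nablaDr lc).
(* As eta(X) = 0, g(nabla_U V, X) = g(phi nabla_U V, phi X). Expanding by [phiE V] leaves g(nabla_U
   psi V, phi X), which skewness and [phiE (psi V)] reduce to psi^2 V. *)
have := metric_phi cs (nabla U V p) (X p); rewrite etaX mulr0 subr0 -(phiE V).
rewrite metricDl.
have := phi_skew cs (nabla U (psi phi ver V) p) (X p).
rewrite -(phiE (psi phi ver V)) metricDl psi2 nablaZ_metric// cE.
rewrite (nablaDr lc) (nablaNr lc) vfieldDE vfieldNE metricDl metricNl.
(* The eta(V) xi part contributes eta(V) g(nabla_U xi, X) = 0. *)
rewrite nablaZ_metric// (nabla_xi_eq0 cs lc) vfield0E metric0l mulr0.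
have -> : sin theta ^+ 2 = 1 - cos theta ^+ 2.
  by have := cos2Dsin2 theta; lra.
lra.
Qed.

End SecondFundamentalForm.

Theorem theorem6 (R : realType) (k n : nat)
    (M : manifold R k.*2.+1) (N : manifold R n)
    (gM : metric M) (gN : metric N)
    (phi : tensor11 M) (xi : vfield M) (eta : one_form M)
    (nabla : vfield M -> vfield M -> vfield M)
    (F : smooth_map M N) (ver : tensor11 M) (theta : R)
    (cosymplectic : is_cosymplectic phi xi eta gM)
    (levi_civita : is_levi_civita gM nabla)
    (submersion : is_riemannian_submersion gM gN F)
    (vertical_projection : is_vertical_projection gM F ver)
    (xi_vertical : is_vertical F xi)
    (slant : is_slant gM phi xi F ver theta)
    (theta_neq0 : theta <> 0) :
  totally_geodesic_foliation nabla (is_vertical F) <->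
  (forall U V X : vfield M,
     is_vertical F U -> is_vertical F V -> is_horizontal gM F X ->
     metric_app gM
       (horproj ver (nabla U (omega phi ver (psi phi ver V)))) X =
     metric_app gM (oneill_T nabla ver U (omega phi ver V)) (calB phi ver X) +
     metric_app gM (horproj ver (nabla U (omega phi ver V))) (calC phi ver X)).

Proof.
(* By [theta_neq0] the slant angle lies in (0, pi/2], where the sine is positive. *)
have sin_neq0 : sin theta ^+ 2 != 0.
  rewrite expf_neq0// gt_eqF// sin_gt0_pi//.
  case: slant => /andP[theta_ge0 theta_le] _.
  rewrite lt_neqAle eq_sym theta_ge0 andbT; apply/andP; split; first exact/eqP.
  by rewrite (le_lt_trans theta_le)// ltr_pdivrMr// ltr_pMr ?pi_gt0// ltr1n.
(* The equivalence holds for each triple of fields separately: by [E] the two sides of the identity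
   differ by sin^2(theta) g(nabla_U V, X). *)
have cond U V X : is_vertical F U -> is_vertical F V -> is_horizontal gM F X ->
    (metric_app gM (horproj ver (nabla U (omega phi ver (psi phi ver V)))) X =
     metric_app gM (oneill_T nabla ver U (omega phi ver V)) (calB phi ver X) +
     metric_app gM (horproj ver (nabla U (omega phi ver V))) (calC phi ver X))
    <-> forall p, gM p (nabla U V p) (X p) = 0.
  move=> FU FV hX.
  have homega : is_horizontal gM F (omega phi ver V).
    by move=> p; exact: (sub_ver_horizontal vertical_projection).
  rewrite (oneill_T_vertical_horizontal levi_civita vertical_projection)//.
  have E p : (metric_app gM (verproj ver (nabla U (omega phi ver V)))
        (calB phi ver X) +
      metric_app gM (horproj ver (nabla U (omega phi ver V)))
        (calC phi ver X)) p =
    metric_app gM (horproj ver (nabla U (omega phi ver (psi phi ver V)))) X p +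
    sin theta ^+ 2 * gM p (nabla U V p) (X p).
    rewrite (slant_second_fundamental_form cosymplectic levi_civita
               vertical_projection xi_vertical slant)//.
    rewrite /= (metric_horproj vertical_projection)// [RHS]addrC subrK.
    (* The vertical and horizontal parts of nabla_U omega V are paired with those of phi X, namely B
       X and C X. *)
    by rewrite [RHS](metric_split vertical_projection).
  split=> [eqf p|eq0].
    have /eqP := E p; rewrite -eqf -subr_eq0 opprD addrA subrr add0r oppr_eq0.
    by rewrite mulf_eq0 (negPf sin_neq0) => /eqP.
  apply: val_inj; apply/funext => p.
  by have := E p; rewrite eq0 mulr0 addr0 => /esym.
split=> [tg U V X FU FV hX|H U V FU FV p].
  apply/cond => // p; rewrite Defs.metric_sym; apply: hX; exact: tg.
(* Test with [X] the horizontal part of [nabla U V]: the product is then the squared length of [X],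
   so [nabla U V] equals its vertical projection. *)
set W := nabla U V.
have hW : is_horizontal gM F (horproj ver W).
  by move=> q; exact: (sub_ver_horizontal vertical_projection).
have /(cond _ _ _ FU FV hW)/(_ p) := H U V _ FU FV hW.
rewrite -(metric_horproj vertical_projection)//= => /metric_eq0/subr0_eq ->.
exact: (ver_vertical vertical_projection).
Qed.
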